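(* Let $\underline z_{STD+}$ be the optimal value of the linear relaxation of the standard formulation (STD) with the addition of all $(l,S_j)$-inequalities $$\sum_{j=1}^{NJ}\Big(\sum_{u\in L\setminus S_j}x^{ij}_u+\sum_{u\in S_j}d^i_{ul}\,y^j_u\Big)\ge d^i_{1l},\qquad i\in I,\ l\in T,\ L=\{1,\ldots,l\},\ S_j\subseteq L\ (j\in J),$$ and let $\underline z_{FL}$ be the optimal value of the linear relaxation of the facility location formulation (FL). Then $\underline z_{STD+}=\underline z_{FL}$.
   Context: Data: items $I=\{1,\ldots,NI\}$, suppliers $J=\{1,\ldots,NJ\}$, periods $T=\{1,\ldots,NT\}$, demands $d^i_t\ge 0$; $d^i_{kt}=\sum_{l=k}^td^i_l$ for $k\le t$; nonnegative costs $P_{ij}$ (unit purchase), $O_j$ (transaction), $H_i$ (unit holding). (STD): minimize $$\sum_{i\in I}\sum_{j\in J}\sum_{t=1}^{NT}P_{ij}x^{ij}_t+\sum_{j\in J}\sum_{t=1}^{NT}O_jy^j_t+\sum_{i\in I}\sum_{t=1}^{NT}H_i\Big(\sum_{j\in J}\sum_{k=1}^tx^{ij}_k-d^i_{1t}\Big)$$ subject to $\sum_{j\in J}\sum_{k=1}^tx^{ij}_k\ge d^i_{1t}$ ($i\in I,t\in T$); $x^{ij}_t\le My^j_t$ ($i\in I,j\in J,t\in T$); $y^j_t\in\{0,1\}$; $x^{ij}_t\ge 0$. Here $M$ is a big constant with $M\ge d^i_{1,NT}$ for all $i\in I$. (FL): minimize $$\sum_{i\in I}\sum_{j\in J}\sum_{t=1}^{NT}\sum_{k=t}^{NT}P_{ij}X^{ij}_{tk}+\sum_{j\in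 J}\sum_{t=1}^{NT}O_jy^j_t+\sum_{i\in I}\sum_{t=1}^{NT}H_i\Big(\sum_{j\in J}\sum_{u=1}^{t}\sum_{k=t+1}^{NT}X^{ij}_{uk}\Big)$$ subject to $\sum_{j\in J}\sum_{t=1}^kX^{ij}_{tk}=d^i_k$ ($i\in I,k\in T$); $X^{ij}_{tk}\le d^i_ky^j_t$ ($i\in I,j\in J,t\in T,k\in\{t,\ldots,NT\}$); $y^j_t\in\{0,1\}$; $X^{ij}_{tk}\ge 0$ ($t\le k$). In each case the linear relaxation replaces $y^j_t\in\{0,1\}$ by $0\le y^j_t\le 1$. *)

(* Defs.v *)
From HB Require Import structures.
From mathcomp Require Import all_boot all_order all_algebra.
From mathcomp Require Import all_classical all_reals all_analysis.

Set Implicit Arguments.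
Unset Strict Implicit.
Unset Printing Implicit Defensive.

Import Order.TTheory GRing.Theory Num.Theory.

Local Open Scope classical_set_scope.
Local Open Scope ring_scope.

(* Items, suppliers and periods are 'I_NI, 'I_NJ and 'I_NT, so period t of the
   mathematical model (1 <= t <= NT) is the ordinal of value t - 1. *)
Record lotsizing (R : realType) (NI NJ NT : nat) := Lotsizing {
  demand : 'I_NI -> 'I_NT -> R;
  purchase : 'I_NI -> 'I_NJ -> R;
  transaction : 'I_NJ -> R;
  holding : 'I_NI -> R
}.

(* The value of the problem min { f v | v in F }, with value +oo when F is
   empty and -oo when f is unbounded below on F. *)
Definition optimal_value (R : realType) (V : Type) (F : set V) (f : V -> R)
  : \bar R := ereal_inf [set (f v)%:E | v in F].

Section Formulations.
Variables (R : realType) (NI NJ NT : nat).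
Variable D : lotsizing R NI NJ NT.

Definition nonneg_data : Prop :=
  [/\ forall i t, 0 <= demand D i t,
      forall i j, 0 <= purchase D i j,
      forall j, 0 <= transaction D j
    & forall i, 0 <= holding D i].

(* d^i_{kt} *)
Definition demand_between (i : 'I_NI) (k t : 'I_NT) : R :=
  \sum_(l < NT | (k <= l <= t)%N) demand D i l.

(* d^i_{1t} *)
Definition demand_upto (i : 'I_NI) (t : 'I_NT) : R :=
  \sum_(l < NT | (l <= t)%N) demand D i l.

(* d^i_{1,NT} *)
Definition demand_total (i : 'I_NI) : R := \sum_(l < NT) demand D i l.

Definition setup_plan := 'I_NJ -> 'I_NT -> R.

Record std_point := StdPoint {
  std_x : 'I_NI -> 'I_NJ -> 'I_NT -> R;
  std_y : setup_plan
}.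

(* fl_X v i j t k is the amount of item i bought from supplier j in period t
   to serve the demand of period k. Only the entries with t <= k are variables
   of the model: the others occur neither in the constraints nor in the cost. *)
Record fl_point := FlPoint {
  fl_X : 'I_NI -> 'I_NJ -> 'I_NT -> 'I_NT -> R;
  fl_y : setup_plan
}.

Definition std_cost (v : std_point) : R :=
  \sum_(i < NI) \sum_(j < NJ) \sum_(t < NT) purchase D i j * std_x v i j t
  + \sum_(j < NJ) \sum_(t < NT) transaction D j * std_y v j t
  + \sum_(i < NI) \sum_(t < NT) holding D i *
      (\sum_(j < NJ) \sum_(k < NT | (k <= t)%N) std_x v i j k
       - demand_upto i t).

(* Y is the domain of the setup variables: [set 0; 1] gives the mixed-integer
   formulation and `[0, 1] its linear relaxation. *)
Definition std_feasible (Y : set R) (M : R) (v : std_point) : Prop :=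
  [/\ forall i t, demand_upto i t <=
        \sum_(j < NJ) \sum_(k < NT | (k <= t)%N) std_x v i j k,
      forall i j t, std_x v i j t <= M * std_y v j t,
      forall j t, Y (std_y v j t)
    & forall i j t, 0 <= std_x v i j t].

Definition lS_inequalities (v : std_point) : Prop :=
  forall (i : 'I_NI) (l : 'I_NT) (S : 'I_NJ -> {set 'I_NT}),
    let L := [set u : 'I_NT | (u <= l)%N]%SET in
    (forall j, S j \subset L) ->
    demand_upto i l <=
      \sum_(j < NJ) (\sum_(u in L :\: S j) std_x v i j u
                     + \sum_(u in S j) demand_between i u l * std_y v j u).

Definition fl_cost (v : fl_point) : R :=
  \sum_(i < NI) \sum_(j < NJ) \sum_(t < NT) \sum_(k < NT | (t <= k)%N)
    purchase D i j * fl_X v i j t k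
  + \sum_(j < NJ) \sum_(t < NT) transaction D j * fl_y v j t
  + \sum_(i < NI) \sum_(t < NT) holding D i *
      (\sum_(j < NJ) \sum_(u < NT | (u <= t)%N) \sum_(k < NT | (t < k)%N)
         fl_X v i j u k).

Definition fl_feasible (Y : set R) (v : fl_point) : Prop :=
  [/\ forall i (k : 'I_NT),
        \sum_(j < NJ) \sum_(t < NT | (t <= k)%N) fl_X v i j t k = demand D i k,
      forall i j (t k : 'I_NT), (t <= k)%N ->
        fl_X v i j t k <= demand D i k * fl_y v j t,
      forall j t, Y (fl_y v j t)
    & forall i j (t k : 'I_NT), (t <= k)%N -> 0 <= fl_X v i j t k].

Definition z_STDplus (M : R) : \bar R :=
  optimal_value [set v | std_feasible `[0, 1] M v /\ lS_inequalities v]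
    std_cost.

Definition z_FL : \bar R := optimal_value (fl_feasible `[0, 1]) fl_cost.

End Formulations.

(* Main.v *)
(* An (FL)-solution X yields the purchases x_t = sum_(k >= t) X_tk, which are
   feasible for (STD) with the (l,S)-inequalities and have the same cost.
   Conversely fix (x, y) and an item. Choosing the sets S_j best possible, the
   (l,S)-inequalities say that for every l
     sum_u min (x_u, d_ul y_u) >= d_1l   (u ranging over (supplier, period)).
   Such purchases can be allocated to the demands period by period: demand d of
   the first period is served by levelling the ratios x_u / y_u, i.e. source u
   gives min (x_u, (a + d) y_u) - min (x_u, a y_u), for a level a found by the
   intermediate value theorem. The inequalities survive for the remaining
   periods: beyond level a they are the old ones minus d, and below level a they
   follow from the concavity of b |-> sum_u min (x_u, b y_u), whose mean slope on
   [a, a + d] is 1. The allocation may leave some purchases unused, which only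
   lowers the cost. *)
Require Import Defs.
From mathcomp Require Import all_boot all_order all_algebra.
From mathcomp Require Import all_classical all_reals all_analysis.
From mathcomp Require Import lra.
Import Order.TTheory GRing.Theory Num.Theory.
Import numFieldNormedType.Exports.
Local Open Scope ring_scope.

(** * Increments of truncated linear functions *)

Lemma continuous_minr_affine (R : realType) (r y c : R) :
  continuous (fun a : R => Num.min r ((a + c) * y)).
Proof.
move=> a.
apply: (@continuous_min R R (cst r) (fun a => (a + c) * y) a).
  exact: cvg_cst.
by apply: cvgMr_tmp; apply: cvgD; [exact: cvg_id | exact: cvg_cst].
Qed.

(** Here [p] and [q] stand for [a * y u] and [d * y u]: [x] is what a source with purchase [r] gives
    when the level rises from [a] to [a + d]. *)
Lemma min_increment_bounds (R : realFieldType) (r p q : R) :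
    0 <= r -> 0 <= p -> 0 <= q ->
  let x := Num.min r (p + q) - Num.min r p in [/\ 0 <= x, x <= q & x <= r].
Proof.
move=> r0 p0 q0 /=.
by case: (leP r p) => ?; case: (leP r (p + q)) => ?; split; lra.
Qed.

Lemma min_increment_above (R : realFieldType) (r p q t : R) : 0 <= q -> p <= t ->
  Num.min r (q + t) - (Num.min r (p + q) - Num.min r p) <=
  Num.min (r - (Num.min r (p + q) - Num.min r p)) t.
Proof.
move=> q0 pt; rewrite le_min; apply/andP.
by case: (leP r p) => ?; case: (leP r (p + q)) => ?;
  case: (leP r (q + t)) => ?; split; lra.
Qed.

Lemma min_increment_below (R : realFieldType) (r p q t : R) : 0 <= q -> t <= p ->
  Num.min r t <= Num.min (r - (Num.min r (p + q) - Num.min r p)) t.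
Proof.
move=> q0 tp; rewrite le_min; apply/andP.
by case: (leP r p) => ?; case: (leP r (p + q)) => ?;
  case: (leP r t) => ?; split; lra.
Qed.

(** * Allocating purchases to demands, period by period *)

Section Transport.
Variables (R : realType) (U : finType).
Implicit Types (r y : U -> R) (d : nat -> R) (s : U -> nat).

(* For [d = 0] every large [a] solves the equation, whence the clause [a = 0]:
   concavity at level [a] gives information only if [0 < d]. *)
Lemma leveling (P : pred U) r y (d : R) :
    (forall u, 0 <= r u) -> (forall u, 0 <= y u) -> 0 <= d ->
    d <= \sum_(u | P u) Num.min (r u) (d * y u) ->
  exists2 a : R, 0 <= a &
    (0 < d \/ a = 0) /\
    \sum_(u | P u)
      (Num.min (r u) ((a + d) * y u) - Num.min (r u) (a * y u)) = d.
Proof.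
move=> r0 y0 d0 dle.
case: (ltrgtP d 0) => [|d_gt0|dz]; first by rewrite ltNge d0.
  (* The [+ 0] makes both terms instances of [continuous_minr_affine]. *)
  pose g (a : R) := \sum_(u | P u)
    (Num.min (r u) ((a + d) * y u) - Num.min (r u) ((a + 0) * y u)).
  have gC : continuous g.
    move=> a; apply: cvg_big => [|u _]; first exact: add_continuous.
    by apply: cvgB; exact: continuous_minr_affine.
  (* At this level every source with [y u != 0] is exhausted, so the increment vanishes; the others
     never contribute. *)
  pose b := \sum_u r u / y u.
  have ry0 u : 0 <= r u / y u by rewrite divr_ge0.
  have b0 : 0 <= b by rewrite sumr_ge0.
  have gb : g b = 0.
    rewrite /g big1 // => u _; rewrite addr0.
    have [->|yn0] := eqVneq (y u) 0; first by rewrite !mulr0 subrr.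
    have yp : 0 < y u by rewrite lt_def yn0 y0.
    have rb : r u <= b * y u.
      by rewrite -ler_pdivrMr // /b (bigD1 u) //= lerDl sumr_ge0.
    rewrite !min_l ?subrr //.
    by rewrite mulrDl (le_trans rb) // lerDl mulr_ge0.
  have g0 : d <= g 0.
    rewrite (le_trans dle) // ler_sum // => u _.
    by rewrite !add0r mul0r (min_r (r0 u)) subr0.
  have [||a ab ga] := @IVT _ g 0 b d b0.
  - exact: continuous_subspaceT.
  - by rewrite gb ge_min le_max d0 g0 orbT.
  exists a; first by move: ab; rewrite in_itv /= => /andP[].
  split; first by left.
  by rewrite -[RHS]ga; apply: eq_bigr => u _; rewrite addr0.
exists 0 => //; split; first by right.
by rewrite dz big1 // => u _; rewrite addr0 subrr.
Qed.

(** Source by source, [min (r u, b * y u)] is concave in [b] and zero at [b = 0], so its mean slope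
    on [[0, D]] is at least that on [[a, a + d]]; the latter slopes sum to 1. *)
Lemma leveling_slope (P : pred U) r y (a d D : R) :
    (forall u, 0 <= r u) -> (forall u, 0 <= y u) -> 0 < d -> 0 <= D <= a ->
    \sum_(u | P u)
      (Num.min (r u) ((a + d) * y u) - Num.min (r u) (a * y u)) = d ->
  D <= \sum_(u | P u) Num.min (r u) (D * y u).
Proof.
move=> r0 y0 d0 /andP[D0 Da] Ed.
rewrite -(ler_pM2l d0) -{1}Ed mulr_suml mulr_sumr; apply: ler_sum => u _.
have yu := y0 u; have ru := r0 u.
have Day : D * y u <= a * y u by rewrite ler_wpM2r.
have dDy : 0 <= d * (D * y u) by rewrite !mulr_ge0 // ltW.
have E1 : (a + d) * y u = a * y u + d * y u by rewrite mulrDl.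
have dy : 0 <= d * y u by rewrite mulr_ge0 // ltW.
case: (leP (r u) (a * y u)) => [ra|ar].
  rewrite min_l ?subrr ?mul0r; last by rewrite E1; lra.
  by apply: mulr_ge0; [exact: ltW | rewrite le_min ru mulr_ge0].
rewrite (min_r (x := r u) (y := D * y u)); last lra.
rewrite [leRHS](_ : _ = (d * y u) * D); last lra.
by rewrite ler_wpM2r // lerBlDr ge_min E1 addrC lexx orbT.
Qed.

(** Induction on the number of periods: serve period 0 by levelling, then shift all periods down by
    one. Source [u] can serve only from period [s u] on. *)
Lemma transport n d s r y :
    (forall k, 0 <= d k) -> (forall u, 0 <= r u) -> (forall u, 0 <= y u) ->
    (forall l, (l <= n)%N -> \sum_(0 <= k < l) d k <=
       \sum_u Num.min (r u) ((\sum_(s u <= k < l) d k) * y u)) ->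
  exists X : U -> nat -> R,
    [/\ forall u k, 0 <= X u k <= d k * y u,
        forall u k, (k < s u)%N -> X u k = 0,
        forall k, (k < n)%N -> \sum_u X u k = d k
      & forall u, \sum_(0 <= k < n) X u k <= r u].
Proof.
elim: n d s r => [|n IHn] d s r d0 r0 y0 cut.
  exists (fun _ _ => 0); split=> // [u k|u]; first by rewrite lexx mulr_ge0.
  by rewrite big_geq.
have [|a a0 [da Ed]] := @leveling (fun u => s u == 0%N) r y (d 0%N) r0 y0 (d0 _).
  (* In the inequality for the first period alone, sources that start later have an empty demand sum
     and drop out. *)
  have := cut 1%N isT; rewrite big_nat1 => /le_trans; apply.
  rewrite (bigID (fun u => s u == 0%N)) /= [X in _ + X]big1 ?addr0.
    by rewrite ler_sum // => u /eqP->; rewrite big_nat1.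
  by move=> u su; rewrite big_geq ?lt0n // mul0r min_r.
pose x u := if s u == 0%N then
  Num.min (r u) ((a + d 0%N) * y u) - Num.min (r u) (a * y u) else 0.
have xP u : [/\ 0 <= x u, x u <= d 0%N * y u & x u <= r u].
  have yu := y0 u; have ru := r0 u.
  have ay : 0 <= a * y u by rewrite mulr_ge0.
  have dy : 0 <= d 0%N * y u by rewrite mulr_ge0.
  rewrite /x; case: ifP => _ //.
  by rewrite mulrDl; exact: min_increment_bounds.
(* [predn] fixes 0, so a source already open stays open. *)
have [||X [X0 Xs Xd Xr]] := IHn (d \o succn) (predn \o s) (fun u => r u - x u)
    (fun k => d0 k.+1) _ y0.
- by move=> u; have [_ _ ?] := xP u; rewrite subr_ge0.
- move=> l ln /=; set D := \sum_(_ <= _ < _) _.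
  have D0 : 0 <= D by rewrite /D sumr_ge0.
  have tail : \sum_(u | s u != 0%N) Num.min (r u)
        ((\sum_(s u <= k < l.+1) d k) * y u) =
      \sum_(u | s u != 0%N) Num.min (r u - x u)
        ((\sum_((s u).-1 <= k < l) d k.+1) * y u).
    apply: eq_bigr => u su; rewrite /x (negbTE su) subr0.
    by rewrite -{1}(@prednK (s u)) ?lt0n // big_add1.
  rewrite (bigID (fun u => s u == 0%N)) /= -tail.
  (* [D] is the demand still to be served up to the cut. Beyond level [a], the old inequality loses
     exactly [d 0]; below it, the open sources alone cover [D]. *)
  case: (leP a D) => [aD|Da].
    have := cut l.+1 ln; rewrite big_nat_recl // -/D.
    rewrite (bigID (fun u => s u == 0%N)) /=.
    set t := \sum_(_ | s _ != _) _.
    suff : \sum_(u | s u == 0%N)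
        Num.min (r u) ((\sum_(s u <= k < l.+1) d k) * y u) - d 0%N <=
      \sum_(u | s u == 0%N) Num.min (r u - x u)
        ((\sum_((s u).-1 <= k < l) d k.+1) * y u) by lra.
    rewrite -[X in _ - X <= _]Ed -sumrB; apply: ler_sum => u su; rewrite /x su.
    rewrite (eqP su) /= big_nat_recl // -/D.
    have yu := y0 u; have ru := r0 u.
    have aDy : a * y u <= D * y u by rewrite ler_wpM2r.
    have dy : 0 <= d 0%N * y u by rewrite mulr_ge0.
    by rewrite !mulrDl min_increment_above.
  rewrite -[D]addr0; apply: lerD; last first.
    apply: sumr_ge0 => u _; rewrite le_min r0 mulr_ge0 //.
    exact: sumr_ge0.
  case: da => [dgt0|az]; last by move: Da; rewrite az => Da; lra.
  have DDa : 0 <= D <= a by rewrite D0 ltW.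
  have := leveling_slope _ _ _ _ _ _ r0 y0 dgt0 DDa Ed.
  move=> /le_trans; apply; apply: ler_sum => u su; rewrite /x su.
  rewrite (eqP su) /= -/D.
  have yu := y0 u; have ru := r0 u.
  have aDy : D * y u <= a * y u by rewrite ler_wpM2r // ltW.
  have dy : 0 <= d 0%N * y u by rewrite mulr_ge0.
  by rewrite !mulrDl min_increment_below.
exists (fun u k => if k is k'.+1 then X u k' else x u); split.
- by move=> u [|k]; [have [-> ->] := xP u | exact: X0].
- move=> u [|k] ksu; last by apply: Xs => /=; case: (s u) ksu.
  by rewrite /x eqn0Ngt ksu.
- move=> [|k] kn; last exact: Xd.
  by rewrite /x -big_mkcond.
- by move=> u; rewrite big_nat_recl //= -lerBrDl.
Qed.

End Transport.

(** * Demands indexed by natural numbers *)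

Lemma big_ord_interval (V : nmodType) (n m : nat) (t : 'I_n) (f : nat -> V) :
  \sum_(k < n | (m <= k <= t)%N) f k = \sum_(m <= k < t.+1) f k.
Proof.
rewrite (big_nat_widen _ _ n) // (big_nat_widenl _ 0%N) // big_mkord.
by apply: eq_bigl => k; rewrite /= ltnS andbC.
Qed.

Section Formulations.
Variables (R : realType) (NI NJ NT : nat) (D : lotsizing R NI NJ NT) (M : R).
Hypothesis D_ge0 : nonneg_data D.

Let demand_ge0 i t : 0 <= demand D i t. Proof. by case: D_ge0. Qed.

(** Extension by 0, since the induction in [transport] shifts periods in [nat]. *)
Definition demand_nat (i : 'I_NI) (k : nat) : R := oapp (demand D i) 0 (insub k).

Lemma demand_natE i (k : 'I_NT) : demand_nat i k = demand D i k.
Proof. by rewrite /demand_nat valK. Qed.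

Lemma demand_nat_ge0 i k : 0 <= demand_nat i k.
Proof. by rewrite /demand_nat; case: insub => //=. Qed.

Lemma demand_betweenE i (k t : 'I_NT) :
  demand_between D i k t = \sum_(k <= l < t.+1) demand_nat i l.
Proof.
by rewrite -big_ord_interval; apply: eq_bigr => l _; rewrite demand_natE.
Qed.

Lemma demand_uptoE i (t : 'I_NT) :
  demand_upto D i t = \sum_(0 <= l < t.+1) demand_nat i l.
Proof.
by rewrite -big_ord_interval; apply: eq_bigr => l _; rewrite demand_natE.
Qed.

Definition fl_purchases (v : fl_point R NI NJ NT) : std_point R NI NJ NT :=
  StdPoint (fun i j t => \sum_(k < NT | (t <= k)%N) fl_X v i j t k) (fl_y v).

(** * From (FL) to (STD) with the (l,S)-inequalities *)

Section FacilityLocation.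
Variable v : fl_point R NI NJ NT.
Hypothesis v_feasible : fl_feasible D `[0, 1]%classic v.

Let demand_met i (k : 'I_NT) :
  \sum_(j < NJ) \sum_(t < NT | (t <= k)%N) fl_X v i j t k = demand D i k.
Proof. by case: v_feasible. Qed.

Let X_le i j (t k : 'I_NT) :
  (t <= k)%N -> fl_X v i j t k <= demand D i k * fl_y v j t.
Proof. by case: v_feasible => _ + _ _; apply. Qed.

Let y01 j t : 0 <= fl_y v j t <= 1.
Proof. by case: v_feasible => _ _ /(_ j t) + _; rewrite /= in_itv. Qed.

Let X_ge0 i j (t k : 'I_NT) : (t <= k)%N -> 0 <= fl_X v i j t k.
Proof. by case: v_feasible => _ _ _; apply. Qed.

Lemma fl_demand_upto i (l : 'I_NT) : demand_upto D i l =
  \sum_(j < NJ) \sum_(u < NT | (u <= l)%N)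
    \sum_(k < NT | (u <= k <= l)%N) fl_X v i j u k.
Proof.
rewrite /demand_upto; under eq_bigr do rewrite -demand_met.
rewrite exchange_big; apply: eq_bigr => j _.
rewrite (exchange_big_dep (fun u : 'I_NT => (u <= l)%N)) /=; last first.
  by move=> k u kl uk; exact: leq_trans kl.
by apply: eq_bigr => u ul; apply: eq_bigl => k; rewrite andbC.
Qed.

Lemma fl_stock i (t : 'I_NT) :
  \sum_(j < NJ) \sum_(u < NT | (u <= t)%N) \sum_(k < NT | (t < k)%N)
    fl_X v i j u k =
  \sum_(j < NJ) \sum_(u < NT | (u <= t)%N) std_x (fl_purchases v) i j u
  - demand_upto D i t.
Proof.
rewrite fl_demand_upto -sumrB; apply: eq_bigr => j _.
rewrite -sumrB; apply: eq_bigr => u ut /=.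
(* The part serving periods up to [t] cancels; what is left serves later periods, for which [u <= k]
   is automatic. *)
rewrite [in RHS](bigID (fun k : 'I_NT => (k <= t)%N)) /= addrC addrK.
apply: eq_bigl => k; rewrite -ltnNge andbC.
by case: ltnP => //= /ltnW tk; rewrite (leq_trans ut).
Qed.

Lemma std_cost_fl_purchases : std_cost D (fl_purchases v) = fl_cost D v.
Proof.
rewrite /std_cost /fl_cost; congr (_ + _ + _).
  apply: eq_bigr => i _; apply: eq_bigr => j _; apply: eq_bigr => t _.
  by rewrite /= mulr_sumr.
by apply: eq_bigr => i _; apply: eq_bigr => t _; rewrite fl_stock.
Qed.

Lemma fl_purchases_feasible :
  (forall i : 'I_NI, demand_total D i <= M) ->
  std_feasible D `[0, 1]%classic M (fl_purchases v).
Proof.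
move=> M_big; split=> /= [i t|i j t|j t|i j t].
- rewrite -subr_ge0 -fl_stock sumr_ge0 // => j _; rewrite sumr_ge0 // => u ut.
  rewrite sumr_ge0 // => k tk; apply: X_ge0.
  exact: leq_trans (ltnW tk).
- have /andP[y0 _] := y01 j t.
  apply: (@le_trans _ _ (demand_total D i * fl_y v j t)); last first.
    by rewrite ler_wpM2r.
  rewrite /demand_total mulr_suml big_mkcond /=; apply: ler_sum => k _.
  by case: ifP => [tk|_]; [exact: X_le | rewrite mulr_ge0].
- by rewrite in_itv /=.
- by rewrite sumr_ge0 // => k /X_ge0.
Qed.

(** Compare what each purchase period contributes to the demand up to [l]: outside [S j] it is part
    of the purchase, inside it is bounded by summing the setup constraints. *)
Lemma fl_purchases_lS : lS_inequalities D (fl_purchases v).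
Proof.
move=> i l S L SL; rewrite fl_demand_upto ler_sum // => j _.
rewrite [leLHS](eq_bigl (fun u => u \in L)) => [|u]; last by rewrite inE.
rewrite [leLHS](big_setID (S j)) /= (finset.setIidPr (SL j)) addrC lerD // ler_sum // => u uS.
- move: uS; rewrite !inE => /andP[_ ul].
  rewrite [leRHS](bigID (fun k : 'I_NT => (k <= l)%N)) /= lerDl sumr_ge0 // => k.
  by case/andP=> uk _; rewrite X_ge0.
- rewrite mulr_suml ler_sum // => k /andP[uk _]; exact: X_le.
Qed.

End FacilityLocation.

Lemma std_cost_le (v w : std_point R NI NJ NT) :
  (forall i j t, std_x v i j t <= std_x w i j t) ->
  std_y v = std_y w -> std_cost D v <= std_cost D w.
Proof.
case: D_ge0 => _ P0 _ H0 vw yE; rewrite /std_cost yE; apply: lerD.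
  rewrite lerD2r; do 3 (apply: ler_sum => ? _).
  exact: ler_wpM2l.
do 2 (apply: ler_sum => ? _); apply: ler_wpM2l => //.
by rewrite lerD2r; do 2 (apply: ler_sum => ? _).
Qed.

(** * From (STD) with the (l,S)-inequalities to (FL) *)

Section Standard.
Variable v : std_point R NI NJ NT.
Hypothesis v_feasible : std_feasible D `[0, 1]%classic M v.
Hypothesis v_lS : lS_inequalities D v.

Let x_ge0 i j t : 0 <= std_x v i j t.
Proof. by case: v_feasible. Qed.

Let y01 j t : 0 <= std_y v j t <= 1.
Proof. by case: v_feasible => _ _ /(_ j t) + _; rewrite /= in_itv. Qed.

Let y_ge0 j t : 0 <= std_y v j t.
Proof. by case/andP: (y01 j t). Qed.

Lemma lS_min i (l : 'I_NT) :
  demand_upto D i l <= \sum_(j < NJ) \sum_(u < NT | (u <= l)%N)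
    Num.min (std_x v i j u) (demand_between D i u l * std_y v j u).
Proof.
(* The best choice of [S j]: take the setup term exactly where it is the smaller one. *)
pose S j := [set u : 'I_NT | (u <= l)%N &&
  (demand_between D i u l * std_y v j u < std_x v i j u)]%SET.
pose L := [set u : 'I_NT | (u <= l)%N]%SET.
have SL j : S j \subset L by apply/fintype.subsetP => u; rewrite !inE => /andP[].
rewrite (le_trans (v_lS i l S SL)) // ler_sum // => j _.
rewrite [leRHS](eq_bigl (fun u => u \in L)) => [|u]; last by rewrite inE.
rewrite [leRHS](big_setID (S j)) /= (finset.setIidPr (SL j)) [leRHS]addrC lerD //.
  rewrite ler_sum // => u; rewrite !inE => /andP[+ ul].
  by rewrite ul /= -leNgt => xy; rewrite min_l.
by rewrite ler_sum // => u; rewrite inE => /andP[_ /ltW yx]; rewrite min_r.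
Qed.

Lemma fl_of_std : exists2 w, fl_feasible D `[0, 1]%classic w &
  fl_y w = std_y v /\
  forall i j t, std_x (fl_purchases w) i j t <= std_x v i j t.
Proof.
have /boolp.choice[X XP] : forall i : 'I_NI, exists X : 'I_NJ * 'I_NT -> nat -> R,
    [/\ forall u k, 0 <= X u k <= demand_nat i k * std_y v u.1 u.2,
        forall (u : 'I_NJ * 'I_NT) k, (k < u.2)%N -> X u k = 0,
        forall k, (k < NT)%N -> \sum_u X u k = demand_nat i k
      & forall u, \sum_(0 <= k < NT) X u k <= std_x v i u.1 u.2].
  move=> i; apply: (transport _ _ _ _ (fun u : 'I_NJ * 'I_NT => nat_of_ord u.2)) => //.
    exact: demand_nat_ge0.
  (* A cut before [l.+1] is the (l,S)-inequality for the ordinal [l]; the cut before 0 is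
     trivial. *)
  move=> [|l] lNT.
    rewrite big_geq // sumr_ge0 // => u _.
    by rewrite le_min x_ge0 mul0r lexx.
  have := lS_min i (Ordinal lNT); rewrite demand_uptoE => /le_trans; apply.
  rewrite -(pair_bigA _ (fun j t => Num.min (std_x v i j t)
    ((\sum_(t <= k < l.+1) demand_nat i k) * std_y v j t))) /=.
  rewrite ler_sum // => j _; rewrite big_mkcond ler_sum // => u _.
  rewrite demand_betweenE; case: ifP => // _.
  rewrite le_min x_ge0 mulr_ge0 // sumr_ge0 // => k _.
  exact: demand_nat_ge0.
exists (FlPoint (fun i j t k => X i (j, t) k) (std_y v)); last first.
  split=> // i j t /=; have [X0 _ _ /(_ (j, t))] := XP i.
  apply: le_trans; rewrite big_mkord big_mkcond /= ler_sum // => k _.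
  by case: ifP => // _; have /andP[] := X0 (j, t) k.
split=> /= [i k|i j t k tk|j t|i j t k tk].
- have [_ Xs Xd _] := XP i.
  have -> : demand D i k = \sum_(j < NJ) \sum_(t < NT) X i (j, t) k.
    by rewrite -demand_natE -Xd // pair_bigA; apply: eq_bigr => -[].
  apply: eq_bigr => j _; rewrite big_mkcond /=; apply: eq_bigr => t _.
  (* No source serves a period before its own, so the full sum has no extra terms. *)
  by case: leqP => // /(Xs (j, t)) ->.
- by have [/(_ (j, t) k)/andP[_ +] _ _ _] := XP i; rewrite demand_natE.
- by rewrite in_itv /=.
- by have [/(_ (j, t) k)/andP[+ _] _ _ _] := XP i.
Qed.

End Standard.
End Formulations.

Theorem corollary12 (R : realType) (NI NJ NT : nat)
    (D : lotsizing R NI NJ NT) (M : R)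
    (D_ge0 : nonneg_data D)
    (M_big : forall i : 'I_NI, demand_total D i <= M) :
  z_STDplus D M = z_FL D.
Proof.
(* Comparing infima point by point requires neither attainment nor nonempty feasible sets. *)
apply/eqP; rewrite eq_le; apply/andP; split.
  apply: le_ereal_inf_tmp => _ [v v_feasible <-].
  apply: ereal_inf_lbound; exists (fl_purchases _ _ _ _ v).
    split; first exact: fl_purchases_feasible.
    exact: fl_purchases_lS v_feasible.
  by rewrite std_cost_fl_purchases.
apply: le_ereal_inf_tmp => _ [v [v_feasible v_lS] <-].
have [w w_feasible [yE xle]] := fl_of_std _ _ _ _ _ _ D_ge0 _ v_feasible v_lS.
apply: (@le_trans _ _ (fl_cost D w)%:E).
  by apply: ereal_inf_lbound; exists w.
rewrite lee_fin -std_cost_fl_purchases //.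
exact: std_cost_le.
Qed.
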